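(* Let $(U(n))_{n\ge 1}$ be independent random variables with $U(n)$ uniformly distributed on $\{1,\dots,n\}$, and let $(T_n)_{n\ge1}$ be defined by $T_1=0$ and $T_{n+1}=1+T_{U(n)}$ for $n\ge 1$. Let $S_n=\sum_{k=1}^n T_k$ and $M_n=n^{-1}(S_n-\mathrm{E}\,S_n)$ for $n\ge1$. Then $(M_n)_{n\ge1}$ is an $L_2$-bounded martingale with respect to the natural filtration $(\mathcal{F}_n)_{n\ge1}$, where $\mathcal{F}_n$ is the $\sigma$-field generated by $T_1,\dots,T_n$ and $U(1),\dots,U(n-1)$. Consequently, as $n\to\infty$, $M_n$ converges almost surely and in mean-square to a non-degenerate random variable $M$. Furthermore, $\mathrm{E}\,M=0$ and $\mathrm{Var}\,M=2-\pi^2/6$.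
   Context: The process $(T_n)$ is called the (uniformly) reverting clock. $L_2$-bounded means $\sup_n \mathrm{E}(M_n^2)<\infty$. Non-degenerate means not almost surely constant. *)

(* Defs.v *)
From HB Require Import structures.
From mathcomp Require Export all_boot all_order all_algebra finmap.
From mathcomp Require Export all_classical all_reals all_analysis.
Export Order.TTheory GRing.Theory Num.Theory.
Export numFieldNormedType.Exports.

Set Implicit Arguments.
Unset Strict Implicit.
Unset Printing Implicit Defensive.

Local Open Scope classical_set_scope.
Local Open Scope ring_scope.

(** Sequences [(x_n)_(n >= 1)] are functions on [nat] whose value at index 0 is
    irrelevant. *)

Definition mutually_independent d d' (Omega : measurableType d)
    (E : measurableType d') (R : realType) (P : probability Omega R)
    (I : choiceType) (D : set I) (X : I -> Omega -> E) : Prop :=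
  forall (J : {fset I}) (B : I -> set E),
    [set` J] `<=` D -> (forall i, measurable (B i)) ->
    P (\bigcap_(i in [set` J]) (X i @^-1` B i)) =
    (\prod_(i <- J) P (X i @^-1` B i))%E.

Definition uniform_on_1_to d (Omega : measurableType d) (R : realType)
    (P : probability Omega R) (n : nat) (X : Omega -> nat) : Prop :=
  forall k : nat,
    P (X @^-1` [set k]) = (if (1 <= k <= n)%N then n%:R^-1 else 0)%:E.

Section reverting_clock.

(** For a driving sequence [u], [clock_hist u n] is the list
    [[:: 0; T_1; ...; T_n]]; the head is a dummy, so that [T_k] sits at
    position [k].  A value [u m] outside [{1, ..., m}] is a junk case (a null
    event when [u m] is uniform on [{1, ..., m}]), for which [T_(m+1) = 1]. *)
Fixpoint clock_hist (u : nat -> nat) (n : nat) : seq nat :=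
  if n is m.+1 then
    let s := clock_hist u m in
    rcons s (if m is 0%N then 0%N else (1 + nth 0 s (u m))%N)
  else [:: 0%N].

Definition clock (u : nat -> nat) (n : nat) : nat := nth 0%N (clock_hist u n) n.

Lemma size_clock_hist u n : size (clock_hist u n) = n.+1.
Proof. by elim: n => // n IHn; rewrite /= size_rcons IHn. Qed.

Lemma nth_clock_hist u n k :
  (k <= n)%N -> nth 0%N (clock_hist u n) k = clock u k.
Proof.
elim: n => [|n IHn]; first by rewrite leqn0 => /eqP ->.
rewrite leq_eqVlt => /predU1P[-> //|]; rewrite ltnS => kn.
by rewrite /= nth_rcons size_clock_hist ltnS kn IHn.
Qed.

Lemma clock_one u : clock u 1 = 0%N.
Proof. by []. Qed.

Lemma clock_succ u n :
  (1 <= n)%N -> (1 <= u n <= n)%N -> clock u n.+1 = (1 + clock u (u n))%N.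
Proof.
case: n => // n _ /andP[_ un].
rewrite -(@nth_clock_hist u _ _ un) {1}/clock [clock_hist u n.+2]/=.
by rewrite -[rcons (clock_hist u n) _]/(clock_hist u n.+1) nth_rcons
           size_clock_hist ltnn eqxx.
Qed.

Context d (Omega : measurableType d) (R : realType) (P : probability Omega R).
Variable U : nat -> Omega -> nat.

Definition clockT (n : nat) (w : Omega) : nat := clock (U^~ w) n.

Definition clockS (n : nat) (w : Omega) : R := (\sum_(1 <= k < n.+1) clockT k w)%N%:R.

Definition clockM (n : nat) (w : Omega) : R :=
  n%:R^-1 * (clockS n w - fine ('E_P[clockS n])).

Definition clockF (n : nat) : set (set Omega) :=
  <<s (\bigcup_(k in [set k | (1 <= k <= n)%N])
         preimage_set_system setT (clockT k) measurable)
      `|` (\bigcup_(k in [set k | (1 <= k <= n.-1)%N])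
         preimage_set_system setT (U k) measurable) >>.

End reverting_clock.

Section martingales.
Context d (Omega : measurableType d) (R : realType) (P : probability Omega R).

Definition measurable_wrt (G : set (set Omega)) (X : Omega -> R) : Prop :=
  preimage_set_system setT X measurable `<=` G.

(** [Y] is a version of the conditional expectation [E(X | G)], for an
    integrable [X] and a sub-sigma-field [G]. *)
Definition is_cond_exp (G : set (set Omega)) (X Y : Omega -> R) : Prop :=
  [/\ measurable_wrt G Y,
      P.-integrable setT (EFin \o Y)
    & forall A, G A -> (\int[P]_(w in A) (Y w)%:E = \int[P]_(w in A) (X w)%:E)%E].

Definition filtration (G : nat -> set (set Omega)) : Prop :=
  [/\ forall n, (1 <= n)%N -> sigma_algebra setT (G n),
      forall n, (1 <= n)%N -> G n `<=` measurable
    & forall m n, (1 <= m)%N -> (m <= n)%N -> G m `<=` G n].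

Definition martingale (G : nat -> set (set Omega)) (X : nat -> Omega -> R) :
    Prop :=
  [/\ filtration G,
      forall n, (1 <= n)%N -> measurable_wrt (G n) (X n),
      forall n, (1 <= n)%N -> P.-integrable setT (EFin \o X n)
    & forall n, (1 <= n)%N -> is_cond_exp (G n) (X n.+1) (X n)].

Definition L2_bounded (X : nat -> Omega -> R) : Prop :=
  (ereal_sup [set 'E_P[(fun w => (X n w ^+ 2)%R)] | n in [set n | (1 <= n)%N]]
     < +oo)%E.

Definition cvg_almost_surely (X : nat -> Omega -> R) (Y : Omega -> R) : Prop :=
  {ae P, forall w, X n w @[n --> \oo] --> Y w}.

Definition cvg_mean_square (X : nat -> Omega -> R) (Y : Omega -> R) : Prop :=
  Y \in Lfun P 2%:E /\
  ('E_P[(fun w => ((X n w - Y w) ^+ 2)%R)] @[n --> \oo] --> 0)%E.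

Definition non_degenerate (Y : Omega -> R) : Prop :=
  ~ exists c : R, {ae P, forall w, Y w = c}.

End martingales.

(* Main.v *)
Require Import Defs.
From mathcomp Require Import ring lra zify measurable_realfun.

(** Given the past up to time n, the next clock value is 1 + T_J with J uniform
    on {1, ..., n} and independent of the past, so its conditional mean is
    1 + S_n / n. Hence S_n / n - (H_n - 1) is a martingale, where
    H_n = 1 + 1/2 + ... + 1/n, and E S_n = n (H_n - 1), so that this martingale
    is M_n. Its increment is (T_J - S_n / n) / (n + 1), whose conditional second
    moment is the empirical variance of T_1, ..., T_n divided by (n + 1)^2.
    Computing the mean of T_1^2 + ... + T_n^2 in the same way turns this into a
    recursion for Var M_n, whose solution is remarkably simple:

        Var M_n = 2 - (1 + 1/4 + ... + 1/n^2) - H_n / n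

    (avg_clock_mart_sqr). It is at most 2, which is the L2 bound, and it tends
    to 2 - pi^2 / 6 by Euler's evaluation of the sum of the inverse squares
    (basel), proved here from the duplication formula of 1 / sin^2.

    All the computations are finite. The state at time n + 1 is a function of
    the first n draws, which almost surely form one of n! equally likely lists;
    expectations of such functions are therefore plain averages over these
    lists (integral_local), and the sigma-field at time n + 1 consists of the
    events about the first n draws (clockFP). The martingale property and the
    orthogonality of the increments become identities between finite sums.

    For the limit, orthogonality gives E (M_n - M_m)^2 = Var M_n - Var M_m for
    m <= n, which is small for large m. Doob's maximal inequality makes almost
    every path Cauchy (ae_cvg_L2_martingale), and Fatou's lemma bounds the
    squared L2 distance from M_n to the limit by 2 - pi^2 / 6 - Var M_n
    (sqr_dist_limit), from which the mean and the variance of the limit follow.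
    The limit is not constant because its variance is at least
    Var M_3 = 1/36. *)

Set Implicit Arguments.
Unset Strict Implicit.
Unset Printing Implicit Defensive.

Local Open Scope classical_set_scope.
Local Open Scope ring_scope.

(** * The sum of the inverse squares *)

Section basel.
Variable R : realType.
Implicit Types (x : R) (n k : nat).

Lemma sin_le_id x : 0 < x -> sin x <= x.
Proof.
move=> x0; have [c _] := @MVT R sin cos 0 x x0 (fun y _ => is_derive_sin y)
  (continuous_subspaceT (@continuous_sin R)).
rewrite sin0 !subr0 => ->.
by rewrite ler_piMl ?cos_le1// ltW.
Qed.

Lemma id_le_tan x : 0 < x < pi / 2 -> x <= tan x.
Proof.
move=> /andP[x0 xpi].
have cos_pos y : 0 <= y <= x -> 0 < cos y.
  move=> /andP[y0 yx]; apply: cos_gt0_pihalf.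
  by rewrite (lt_le_trans _ y0)/= ?(le_lt_trans yx)// oppr_lt0 divr_gt0 ?pi_gt0.
have [||c /[!in_itv]/= /andP[c0 cx]] :=
  @MVT R tan (fun y => (cos y) ^- 2) 0 x x0.
- move=> y /[!in_itv]/= /andP[y0 yx]; apply: is_derive_tan.
  by rewrite gt_eqF// cos_pos// (ltW y0) ltW.
- apply: continuous_in_subspaceT => y /set_mem/= /[!in_itv]/= yx.
  by apply: continuous_tan; rewrite gt_eqF// cos_pos.
rewrite tan0 !subr0 => ->.
have cc : 0 < cos c by rewrite cos_pos// !ltW.
by rewrite ler_peMl ?(ltW x0)// invf_ge1 ?exprn_gt0// exprn_ile1 ?cos_le1 ?(ltW cc).
Qed.

Definition csc2 x : R := (sin x) ^- 2.

(** This is sin x <= x <= tan x, because csc^2 x - 1 = cot^2 x. *)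
Lemma csc2_bounds x : 0 < x < pi / 2 -> csc2 x - 1 <= x ^- 2 <= csc2 x.
Proof.
move=> xpi; have /andP[x0 xlt] := xpi.
have s0 : 0 < sin x by exact: sin_gt0_pihalf.
have c0 : 0 < cos x.
  by apply: cos_gt0_pihalf; rewrite xlt (lt_trans _ x0)// oppr_lt0 divr_gt0 ?pi_gt0.
apply/andP; split; last first.
  rewrite /csc2 lef_pV2 ?posrE ?exprn_gt0//.
  by rewrite lerXn2r ?nnegrE ?(ltW s0) ?(ltW x0)// sin_le_id.
have -> : csc2 x - 1 = (tan x) ^- 2.
  rewrite /csc2 /tan expr_div_n invf_div.
  rewrite cos2sin2; field; exact: lt0r_neq0.
have t0 : 0 < tan x by rewrite divr_gt0.
rewrite lef_pV2 ?posrE ?exprn_gt0//.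
by rewrite lerXn2r ?nnegrE ?(ltW t0) ?(ltW x0)// id_le_tan.
Qed.

Lemma csc2_double x : sin x != 0 -> cos x != 0 ->
  csc2 x + csc2 (x + pi / 2) = 4 * csc2 (x *+ 2).
Proof.
move=> s0 c0; rewrite /csc2 sinDpihalf sin_mulr2n.
have -> : sin x ^- 2 + cos x ^- 2 =
    (cos x ^+ 2 + sin x ^+ 2) / (sin x * cos x) ^+ 2.
  by field; rewrite s0 c0.
rewrite cos2Dsin2 -mulr_natl; field; by rewrite s0 c0.
Qed.

Lemma csc2_reflect x : csc2 (pi - x) = csc2 x.
Proof. by rewrite /csc2 sinB sinpi cospi mul0r sub0r mulN1r opprK. Qed.

Lemma csc2_pihalf : csc2 (pi / 2) = 1.
Proof. by rewrite /csc2 sin_pihalf expr1n invr1. Qed.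

Lemma dyadic_angle_mid n : (2 ^ n)%:R * pi / 2 ^+ n.+1 = pi / 2 :> R.
Proof. by rewrite natrX exprS; field; rewrite expf_neq0. Qed.

Lemma dyadic_angle_lt_pihalf n k : (1 <= k < 2 ^ n)%N ->
  0 < (k%:R * pi / 2 ^+ n.+1 : R) < pi / 2.
Proof.
move=> /andP[k1 k2]; apply/andP; split.
  by rewrite divr_gt0 ?mulr_gt0 ?pi_gt0 ?exprn_gt0 ?ltr0n.
rewrite exprS invfM mulrCA mulrC ltr_pM2r ?invr_gt0// mulrAC gtr_pMl ?pi_gt0//.
by rewrite ltr_pdivrMr ?exprn_gt0// mul1r -natrX ltr_nat.
Qed.

Lemma sum_dyadic_split (g : nat -> R) n :
  \sum_(1 <= k < (2 ^ n.+1)%N) g k = \sum_(1 <= k < (2 ^ n)%N) g k +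
    (g (2 ^ n)%N + \sum_(1 <= k < (2 ^ n)%N) g (k + 2 ^ n)%N).
Proof.
have le2 : (2 ^ n <= 2 ^ n.+1)%N by rewrite leq_exp2l.
rewrite (@big_cat_nat _ _ _ (2 ^ n)%N) ?expn_gt0//=.
rewrite [X in _ + X]big_ltn ?ltn_exp2l// -[(2 ^ n).+1]add1n big_addn.
by rewrite expnS mul2n -addnn addnK.
Qed.

(** Pairing the angles x and x + pi/2 turns the sum at one dyadic level into
    four times the sum at the previous level; only pi/2 has no partner. *)
Lemma sum_csc2 n :
  \sum_(1 <= k < (2 ^ n)%N) csc2 (k%:R * pi / 2 ^+ n) = (4 ^+ n - 1) / 3.
Proof.
elim: n => [|n IHn]; first by rewrite big_geq// subrr mul0r.
rewrite sum_dyadic_split addrCA -big_split/=.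
under eq_big_nat => k kn.
  have -> : (k + 2 ^ n)%:R * pi / 2 ^+ n.+1 =
      k%:R * pi / 2 ^+ n.+1 + pi / 2 :> R.
    by rewrite natrD natrX exprS; field; rewrite expf_neq0.
  have /andP[x0 x1] := dyadic_angle_lt_pihalf kn.
  rewrite csc2_double; last 2 first.
  - by rewrite gt_eqF// sin_gt0_pihalf// x0.
  - rewrite gt_eqF// cos_gt0_pihalf// x1 (lt_trans _ x0)//.
    by rewrite oppr_lt0 divr_gt0 ?pi_gt0.
  have -> : (k%:R * pi / 2 ^+ n.+1 *+ 2) = k%:R * pi / 2 ^+ n :> R.
    by rewrite -mulr_natl exprS; field; rewrite expf_neq0.
  over.
rewrite -mulr_sumr IHn dyadic_angle_mid csc2_pihalf.
by rewrite [in RHS]exprS; field.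
Qed.

Lemma sum_csc2_half n :
  \sum_(1 <= k < (2 ^ n)%N) csc2 (k%:R * pi / 2 ^+ n.+1) = (2 * 4 ^+ n - 2) / 3.
Proof.
have := sum_csc2 n.+1.
rewrite sum_dyadic_split dyadic_angle_mid csc2_pihalf.
(* the angles above pi/2 are the mirror images of those below *)
rewrite [X in _ + (_ + X)]big_nat_rev/=.
rewrite [X in _ + (_ + X)](eq_big_nat _ _
  (F2 := fun k => csc2 (k%:R * pi / 2 ^+ n.+1))).
  set s := \sum_(_ <= _ < _) _ => e.
  have -> : s = ((4 ^+ n.+1 - 1) / 3 - 1) / 2 by rewrite -e; field.
  by rewrite exprS; field.
move=> k /andP[k1 k2]; rewrite -csc2_reflect; congr csc2.
have k2S : (k < 2 ^ n.+1)%N by rewrite (leq_trans k2)// leq_exp2l.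
have -> : (1 + 2 ^ n - k.+1 + 2 ^ n = 2 ^ n.+1 - k)%N.
  by move: k2; rewrite expnS; lia.
rewrite natrB; last exact: ltnW.
by rewrite natrX; field; rewrite expf_neq0.
Qed.

Definition harm2 n : R := \sum_(0 <= k < n) k.+1%:R ^- 2.

(** Up to the factor pi^2 / 4^(n+1), the term k^-2 is x^-2 at the dyadic angle
    x = k pi / 2^(n+1), and csc2_bounds loses at most 1 on each of the
    2^n - 1 terms. *)
Lemma harm2_bounds n :
  (pi ^+ 2 / 6) * (1 - 3 / 2 * 2^-1 ^+ n) <= harm2 (2 ^ n).-1 <= pi ^+ 2 / 6.
Proof.
have p2 : (0 < 2 ^ n)%N by rewrite expn_gt0.
have -> : harm2 (2 ^ n).-1 = \sum_(1 <= k < (2 ^ n)%N) k%:R ^- 2.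
  by rewrite -[in RHS](prednK p2) big_add1/=.
have pi20 : 0 < pi ^+ 2 :> R by rewrite exprn_gt0 ?pi_gt0.
set s := \sum_(_ <= _ < _) _.
have inv_sqE k : k%:R ^- 2 = pi ^+ 2 / 4 ^+ n.+1 * (k%:R * pi / 2 ^+ n.+1) ^- 2 :> R.
  have [->|k0] := eqVneq k 0%N; first by rewrite !(mul0r, expr0n, invr0, mulr0).
  have -> : (4 : R) = 2 ^+ 2 by rewrite -natrX.
  have t0 : 2 ^+ n.+1 != 0 :> R by rewrite expf_neq0.
  have pi0 : pi != 0 :> R by rewrite gt_eqF ?pi_gt0.
  rewrite -exprM mulnC exprM; move: (pi : R) pi0 => p p0; field.
  by rewrite t0 p0 pnatr_eq0 k0.
have scaled : s = pi ^+ 2 / 4 ^+ n.+1 *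
    \sum_(1 <= k < (2 ^ n)%N) (k%:R * pi / 2 ^+ n.+1) ^- 2.
  by rewrite mulr_sumr; apply: eq_bigr => k _; rewrite inv_sqE.
have c0 : 0 < pi ^+ 2 / 4 ^+ n.+1 :> R by rewrite divr_gt0 ?exprn_gt0 ?pi_gt0.
have bnd k (kn : (1 <= k < 2 ^ n)%N) :=
  csc2_bounds (dyadic_angle_lt_pihalf kn).
have two0 : (2 : R) ^+ n != 0 by rewrite expf_neq0.
have four : (4 : R) ^+ n = 2 ^+ n * 2 ^+ n.
  by rewrite -exprMn; congr (_ ^+ _); rewrite -natrM.
rewrite scaled; apply/andP; split.
  apply: (@le_trans _ _ (pi ^+ 2 / 4 ^+ n.+1 *
     \sum_(1 <= k < (2 ^ n)%N) (csc2 (k%:R * pi / 2 ^+ n.+1) - 1))); last first.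
    by rewrite ler_pM2l// ler_sum_nat// => k /bnd/andP[].
  rewrite sumrB sum_csc2_half sumr_const_nat natrB// natrX.
  rewrite -subr_ge0 [leRHS](_ : _ = pi ^+ 2 / 4 ^+ n.+1 * (3^-1)).
    by rewrite mulr_ge0// ?ltW// invr_ge0.
  by rewrite [4 ^+ n.+1]exprS four exprVn; field.
apply: (@le_trans _ _ (pi ^+ 2 / 4 ^+ n.+1 *
     \sum_(1 <= k < (2 ^ n)%N) csc2 (k%:R * pi / 2 ^+ n.+1))).
  by rewrite ler_pM2l// ler_sum_nat// => k /bnd/andP[].
rewrite sum_csc2_half -subr_ge0 [leRHS](_ : _ = pi ^+ 2 / 4 ^+ n.+1 * (2 / 3)).
  by rewrite mulr_ge0// ?ltW// divr_gt0.
by rewrite [4 ^+ n.+1]exprS four; field.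
Qed.

Lemma basel : harm2 @ \oo --> pi ^+ 2 / 6.
Proof.
have nd : nondecreasing_seq harm2.
  apply/nondecreasing_seqP => n.
  by rewrite /harm2 big_nat_recr//= lerDl invr_ge0 exprn_ge0.
have ub n : harm2 n <= pi ^+ 2 / 6.
  have /andP[_] := harm2_bounds n; apply: le_trans; apply: nd.
  by rewrite -ltnS prednK ?expn_gt0// ltn_expl.
have pi20 : 0 < pi ^+ 2 / 6 :> R by rewrite divr_gt0// exprn_gt0 ?pi_gt0.
apply/cvgrPdist_le => e e0.
have : (1 - 3 / 2 * 2^-1 ^+ n : R) @[n --> \oo] --> (1 - 3 / 2 * 0 : R).
  apply: cvgB; first exact: cvg_cst.
  apply: cvgMr; apply: cvg_expr.
  by rewrite ger0_norm ?invr_ge0// invf_lt1 ?ltr1n.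
rewrite mulr0 subr0 => /cvgrPdist_le /(_ (e / (pi ^+ 2 / 6)) (divr_gt0 e0 pi20)).
move=> [N _ /(_ N (leqnn N))] hN.
exists (2 ^ N).-1 => // n /= Nn.
rewrite ger0_norm ?subr_ge0//.
have /andP[+ _] := harm2_bounds N.
move=> /le_trans /(_ (nd _ _ Nn)).
rewrite ler_pdivlMr// in hN.
move: hN; rewrite opprB addrCA subrr addr0 => hN.
have := ler_norm (3 / 2 * 2^-1 ^+ N : R).
by set a := 3 / 2 * _ in hN *; nra.
Qed.

End basel.

(** * Almost sure convergence of square-integrable martingales *)

Section almost_sure_convergence.
Context (R : realType) d (Omega : measurableType d) (P : probability Omega R).

Lemma sigma_algebraU (G : set (set Omega)) A B :
  sigma_algebra setT G -> G A -> G B -> G (A `|` B).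
Proof.
move=> sG GA GB; rewrite -bigcup2E; case: sG => G0 _; apply.
by case=> [|[|n]].
Qed.

(** By induction on n, for the stronger bound by the integral over the event
    itself: the part already reached at time n is carried to time n.+1 by the
    submartingale property, and on the newly reached part Z n.+1 >= c. *)
Lemma doob_maximal_inequality (G : nat -> set (set Omega))
    (Z : nat -> Omega -> R) (c : R) (n : nat) : 0 <= c ->
  (forall k, sigma_algebra setT (G k)) ->
  (forall k, G k `<=` measurable) ->
  (forall k, G k `<=` G k.+1) ->
  (forall k, G k [set w | (c <= Z k w)%R]) ->
  (forall k, measurable_fun setT (Z k)) ->
  (forall k w, 0 <= Z k w) ->
  (forall k A, G k A ->
     (\int[P]_(w in A) (Z k w)%:E <= \int[P]_(w in A) (Z k.+1 w)%:E)%E) ->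
  (c%:E * P (\big[setU/set0]_(k < n.+1) [set w | (c <= Z k w)%R]) <=
   \int[P]_w (Z n w)%:E)%E.
Proof.
move=> c0 sG mG ndG GE mZ Z0 subZ.
set B := fun n => \big[setU/set0]_(k < n.+1) [set w | (c <= Z k w)%R].
have mZD k A : measurable A -> measurable_fun A (EFin \o Z k).
  by move=> mA; apply/measurable_EFinP; exact: measurable_funTS.
have GB k : G k (B k).
  elim: k => [|k IHk]; first by rewrite /B big_ord_recr big_ord0/= set0U; exact: GE.
  by rewrite /B big_ord_recr; apply: sigma_algebraU => //; exact/ndG.
have cE k A : measurable A -> A `<=` [set w | (c <= Z k w)%R] ->
    (c%:E * P A <= \int[P]_(w in A) (Z k w)%:E)%E.
  move=> mA AE; rewrite -integral_cst//; apply: ge0_le_integral => //.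
  exact: mZD.
have key : (c%:E * P (B n) <= \int[P]_(w in B n) (Z n w)%:E)%E.
  elim: n => [|k IHk].
    by apply: cE; [exact/mG/GB|rewrite /B big_ord_recr big_ord0/= set0U].
  set E := [set w | c <= Z k.+1 w].
  have BE : B k.+1 = B k `|` (E `\` B k).
    rewrite /B big_ord_recr/= -/(B k) -/E; apply/seteqP; split => w.
      by move=> [Bw|Ew]; [left|have [Bw|nBw] := pselect (B k w); [left|right]].
    by move=> [Bw|[Ew _]]; [left|right].
  have mB : measurable (B k) by exact/mG/GB.
  have mEB : measurable (E `\` B k) by apply: measurableD => //; exact/(mG k.+1)/GE.
  have dBE : [disjoint B k & E `\` B k] by apply/disj_setPS => w [Bw []].
  rewrite BE measureU//; last by apply/eqP; exact: dBE.
  rewrite ge0_integral_setU//; last 2 first.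
    exact/mZD/measurableU.
    by move=> w _; rewrite lee_fin.
  rewrite ge0_muleDr//; apply: leeD; last by apply: cE => // w [].
  exact: (le_trans IHk (subZ _ _ (GB k))).
apply: (le_trans key); apply: ge0_subset_integral => //.
- exact/mG/GB.
- exact: mZD.
- by move=> w _; rewrite lee_fin.
Qed.

(** For a suitable m, the path leaves the ball of squared radius c around X m
    with probability as small as desired, so that almost every path is
    Cauchy. *)
Lemma ae_cvg_of_maximal (X : nat -> Omega -> R) :
  (forall n, measurable_fun setT (X n)) ->
  (forall c e, 0 < c -> 0 < e -> exists m, forall n,
     (P (\big[setU/set0]_(k < n.+1)
            [set w | (c <= (X (m + k)%N w - X m w) ^+ 2)%R])
       <= e%:E)%E) ->
  {ae P, forall w, cvgn (X ^~ w)}.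
Proof.
move=> mX maxX.
pose E (c : R) m k := [set w | (c <= (X (m + k)%N w - X m w) ^+ 2)%R].
have mE c m k : measurable (E c m k).
  rewrite -[E c m k]setTI; apply: measurable_fun_le => //.
  by apply: measurable_funX; exact: measurable_funB.
(* outside of all the N j, the path has small oscillation at every scale *)
pose N (j : nat) := \bigcap_m \bigcup_k E (j.+1%:R^-1 ^+ 2) m k.
have mUE c m : measurable (\bigcup_k E c m k) by exact: bigcupT_measurable.
have N0 j : P.-negligible (N j).
  have mN : measurable (N j) by exact: bigcapT_measurable.
  apply/negligibleP => //; apply/eqP; rewrite eq_le measure_ge0 andbT.
  apply/lee_addgt0Pr => e e0; rewrite add0e.
  have c0 : 0 < j.+1%:R^-1 ^+ 2 :> R by rewrite exprn_gt0.
  have [m Hm] := maxX _ _ c0 e0.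
  apply: (@le_trans _ _ (P (\bigcup_k E (j.+1%:R^-1 ^+ 2) m k))).
    by apply: le_measure; rewrite ?inE//; exact: bigcap_inf.
  pose F n := \big[setU/set0]_(k < n.+1) E (j.+1%:R^-1 ^+ 2) m k.
  have EF : \bigcup_k E (j.+1%:R^-1 ^+ 2) m k = \bigcup_n F n.
    apply/seteqP; split => w [k _].
      by exists k => //; rewrite /F big_ord_recr/=; right.
    by rewrite /F -bigcup_mkord => -[l _ El]; exists l.
  rewrite EF; have Fcvg : P \o F @ \oo --> P (\bigcup_n F n).
    apply: nondecreasing_cvg_mu; first by move=> i; exact: bigsetU_measurable.
      by rewrite -EF.
    by move=> a b ab; apply/subsetPset; exact: subset_bigsetU.
  rewrite -(cvg_lim _ Fcvg)//; apply: lime_le; first by apply: cvgP Fcvg.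
  by apply: nearW => n; exact: Hm.
have := negligible_bigcup N0; apply: negligibleS => w /= ncvg.
apply: contrapT => nN; apply: ncvg.
apply/cauchy_cvgP/cauchyP => e e0.
have [j je] : exists j : nat, j.+1%:R^-1 < e.
  by have [j _ /(_ j (leqnn j)) je] := near_infty_natSinv_lt (PosNum e0); exists j.
have [m Hm] : exists m, forall k, ~ E (j.+1%:R^-1 ^+ 2) m k w.
  apply: contrapT => /forallNP H; apply: nN; exists j => // m _.
  by have /existsNP [k /contrapT Ek] := H m; exists k.
exists (X m w); exists m => // n /= mn.
have /negP := Hm (n - m)%N; rewrite /E/= subnKC// -ltNge => h.
rewrite /ball/= distrC (lt_trans _ je)//.
by rewrite -(ltr_pXn2r (n := 2)) ?nnegrE// real_normK ?num_real.
Qed.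

Lemma measurable_wrtP (G : set (set Omega)) (X : Omega -> R) :
  sigma_algebra setT G ->
  measurable_wrt G X <-> measurable_fun setT (X : g_sigma_algebraType G -> R).
Proof.
move=> sG.
have mG : @measurable _ (g_sigma_algebraType G) = G by exact: sigma_algebra_id.
split=> [mX _ B mB|mX _ [B mB <-]]; first by rewrite mG; apply: mX; exists B.
by rewrite -mG; exact: mX.
Qed.

(** Doob's inequality, applied to the squared distances to X m after time m,
    which form a submartingale of expectation as small as desired. *)
Lemma ae_cvg_L2_martingale (G : nat -> set (set Omega))
    (X : nat -> Omega -> R) :
  (forall k, sigma_algebra setT (G k)) ->
  (forall k, G k `<=` measurable) ->
  (forall k, G k `<=` G k.+1) ->
  (forall k, measurable_wrt (G k) (X k)) ->
  (forall m k A, (m <= k)%N -> G k A ->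
     (\int[P]_(w in A) ((X k w - X m w) ^+ 2)%:E <=
      \int[P]_(w in A) ((X k.+1 w - X m w) ^+ 2)%:E)%E) ->
  (forall e, 0 < e -> exists m, forall n, (m <= n)%N ->
     (\int[P]_w ((X n w - X m w) ^+ 2)%:E <= e%:E)%E) ->
  {ae P, forall w, cvgn (X ^~ w)}.
Proof.
move=> sG mG ndG adX subX cauchyX.
have GW m k : (m <= k)%N -> G m `<=` G k.
  by move=> /subnK <-; elim: (k - m)%N => // i IHi; apply: subset_trans (ndG _).
have mX k : measurable_fun setT (X k).
  by move=> _ B mB; apply: (mG k); apply: adX; exists B.
apply: ae_cvg_of_maximal => // c e c0 e0.
(* Doob's inequality divides the expectation by c *)
have [m Hm] := cauchyX (c * e) (mulr_gt0 c0 e0).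
exists m => n.
have := @doob_maximal_inequality (fun k => G (m + k)%N)
  (fun k w => (X (m + k)%N w - X m w) ^+ 2) c n (ltW c0)
  (fun k => sG _) (fun k => mG _).
have le := Hm (m + n)%N (leq_addr _ _).
move=> /(_ _ _ _ _ _)/le_trans/(_ le); rewrite EFinM lee_pmul2l ?ltry ?lte_fin//.
apply.
- by move=> k; rewrite addnS; exact: ndG.
- move=> k; have mk : (m <= m + k)%N := leq_addr _ _.
  have E : @measurable _ (g_sigma_algebraType (G (m + k)%N)) = G (m + k)%N.
    exact: sigma_algebra_id.
  rewrite -[X in _ X]setTI -E; apply: measurable_fun_le => //.
  apply: measurable_funX; apply: measurable_funB; apply/measurable_wrtP => //.
  by move=> A /adX; exact: GW.
- by move=> k; apply: measurable_funX; exact: measurable_funB.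
- by move=> k w; exact: sqr_ge0.
- by move=> k A; rewrite addnS; apply: subX; exact: leq_addr.
Qed.

Lemma ae_limit_RV (X : nat -> Omega -> R) :
  (forall n, measurable_fun setT (X n)) -> {ae P, forall w, cvgn (X ^~ w)} ->
  exists Y : {RV P >-> R}, cvg_almost_surely P X Y.
Proof.
move=> mX cX.
(* a limit superior is measurable whether or not the path converges *)
pose Y w := fine (limn_esup (fun n => (X n w)%:E)).
have mY : measurable_fun setT Y.
  apply: measurableT_comp => //; apply: measurable_fun_limn_esup => n.
  exact/measurable_EFinP.
exists (mfun_Sub (mem_set mY : Y \in mfun)).
apply: filterS cX => w cw.
have Xl : (X n w)%:E @[n --> \oo] --> (limn (X ^~ w))%:E.
  by apply: cvg_EFin; [apply: nearW|exact: cw].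
have -> : mfun_Sub (mem_set mY : Y \in mfun) w = limn (X ^~ w).
  by rewrite /= /Y (cvg_limn_einf_sup Xl).2.
exact: cw.
Qed.

Lemma Lfun2_sqr (f : Omega -> R) : measurable_fun setT f ->
  (\int[P]_w (f w ^+ 2)%:E < +oo)%E -> f \in Lfun P 2%:E.
Proof.
move=> mf f2; rewrite inE; apply/andP; split; rewrite inE//=.
rewrite /finite_norm unlock poweR_lty//.
rewrite (eq_integral (fun w => (f w ^+ 2)%:E))// => w _ /=.
by rewrite powR_mulrn// real_normK ?num_real.
Qed.

(** Fatou's lemma; Z is a term of the sequence, which gives the rate of
    convergence, or 0, which gives the square integrability of the limit. *)
Lemma fatou_sqr_dist (X : nat -> Omega -> R) (Y Z : Omega -> R)
    (a : nat -> R) (l : R) :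
  (forall n, measurable_fun setT (X n)) -> measurable_fun setT Y ->
  measurable_fun setT Z -> cvg_almost_surely P X Y ->
  (\forall n \near \oo, (\int[P]_w ((X n w - Z w) ^+ 2)%:E = (a n)%:E)%E) ->
  a @ \oo --> l ->
  (\int[P]_w ((Y w - Z w) ^+ 2)%:E <= l%:E)%E.
Proof.
move=> mX mY mZ XY aE al.
have mXZ n : measurable_fun setT (fun w => ((X n w - Z w) ^+ 2)%:E).
  by apply/measurable_EFinP; apply: measurable_funX; exact: measurable_funB.
have -> : (\int[P]_w ((Y w - Z w) ^+ 2)%:E =
    \int[P]_w limn_einf (fun n => ((X n w - Z w) ^+ 2)%:E))%E.
  apply: ae_eq_integral => //.
  - by apply/measurable_EFinP; apply: measurable_funX; exact: measurable_funB.
  - rewrite (_ : (fun _ => _) = (fun w =>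
      - limn_esup (fun n => - ((X n w - Z w) ^+ 2)%:E))%E); last first.
      by apply/funext => w; rewrite -[RHS]limn_einfN; congr limn_einf;
        apply/funext => n /=; rewrite opprK.
    apply: measurableT_comp => //; apply: measurable_fun_limn_esup => n.
    exact: measurableT_comp.
  - apply: filterS XY => w Xw _.
    have : ((X n w - Z w) ^+ 2)%:E @[n --> \oo] --> ((Y w - Z w) ^+ 2)%:E.
      apply: cvg_EFin; first by apply: nearW.
      by rewrite /comp/= expr2; apply: cvgM; apply: cvgB => //; exact: cvg_cst.
    by move=> /cvg_limn_einf_sup[-> _].
apply: (le_trans (fatou _ _ _ _)) => //.
  by move=> n w _; rewrite lee_fin sqr_ge0.
have : (\int[P]_w ((X n w - Z w) ^+ 2)%:E @[n --> \oo] --> l%:E)%E.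
  have aEl : (a n)%:E @[n --> \oo] --> l%:E.
    by apply: cvg_EFin; [apply: nearW|exact: al].
  by apply: cvg_trans aEl; apply: near_eq_cvg; apply: filterS aE => n /= ->.
by move=> /cvg_limn_einf_sup[-> _].
Qed.
End almost_sure_convergence.

(** * Mean-square convergence and moments of the limit *)

Section mean_square_limit.
Context (R : realType) d (Omega : measurableType d) (P : probability Omega R).
Variables (X : nat -> Omega -> R) (Y : {RV P >-> R}) (v : nat -> R) (l : R).
Hypothesis mX : forall n, measurable_fun setT (X n).
Hypothesis XY : cvg_almost_surely P X Y.
Hypothesis X_mean0 : forall n, ('E_P[X n] = 0)%E.
Hypothesis X_sqr : forall n, (\int[P]_w (X n w ^+ 2)%:E = (v n)%:E)%E.
Hypothesis X_dist : forall m n, (m <= n)%N ->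
  (\int[P]_w ((X n w - X m w) ^+ 2)%:E = (v n - v m)%:E)%E.
Hypothesis vl : v @ \oo --> l.

Let mY : measurable_fun setT Y.
Proof. exact: measurable_funPT. Qed.

Let mXY n : measurable_fun setT (fun w => X n w - Y w).
Proof. exact: measurable_funB. Qed.

Lemma sqr_dist_limit n :
  (\int[P]_w ((X n w - Y w) ^+ 2)%:E <= (l - v n)%:E)%E.
Proof.
have := @fatou_sqr_dist R d Omega P X Y (X n) (fun k => v k - v n) (l - v n)
  mX mY (mX n) XY.
under eq_integral do rewrite -sqrrN opprB.
apply; last by apply: cvgB => //; exact: cvg_cst.
by exists n => // k /= nk; exact: X_dist.
Qed.

Lemma sqr_limit : (\int[P]_w (Y w ^+ 2)%:E <= l%:E)%E.
Proof.
have := @fatou_sqr_dist R d Omega P X Y (cst 0) v l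
  mX mY (@measurable_cst _ _ _ _ _ _) XY.
under eq_integral do rewrite subr0.
apply => //; apply: nearW => n.
by under eq_integral do rewrite subr0; exact: X_sqr.
Qed.

Lemma limit_Lfun2 : (Y : Omega -> R) \in Lfun P 2%:E.
Proof. by apply: Lfun2_sqr => //; rewrite (le_lt_trans sqr_limit)// ltry. Qed.

Lemma diff_Lfun2 n : (fun w => X n w - Y w) \in Lfun P 2%:E.
Proof. by apply: Lfun2_sqr => //; rewrite (le_lt_trans (sqr_dist_limit n))// ltry. Qed.

Lemma X_Lfun2 n : X n \in Lfun P 2%:E.
Proof. by apply: Lfun2_sqr => //; rewrite X_sqr ltry. Qed.

Let Lfun21 (f : Omega -> R) : f \in Lfun P 2%:E -> f \in Lfun P 1.
Proof. by move=> f2; apply: Lfun_subset12 => //; exact: fin_num_measure. Qed.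

Let lvn0 : (l - v n)%:E @[n --> \oo] --> (0 : \bar R)%E.
Proof.
apply: cvg_EFin; first by apply: nearW.
by rewrite -(subrr l); apply: cvgB => //; exact: cvg_cst.
Qed.

Lemma mean_square_limit : cvg_mean_square P X Y.
Proof.
split; first exact: limit_Lfun2.
apply: (@squeeze_cvge _ _ _ _ (cst 0%E) _ (fun n => (l - v n)%:E));
  [apply: nearW => n|exact: cvg_cst|exact: lvn0].
rewrite unlock sqr_dist_limit andbT integral_ge0// => w _.
by rewrite lee_fin sqr_ge0.
Qed.

(** The variance of X n - Y is nonnegative, so that
    (E Y)^2 <= E (X n - Y)^2. *)
Lemma expectation_limit : ('E_P[Y] = 0)%E.
Proof.
have Y1 := Lfun21 limit_Lfun2.
have [m EY] : exists m, ('E_P[Y] = m%:E)%E.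
  by exists (fine 'E_P[Y]); rewrite fineK//; exact: expectation_fin_num.
have bound n : m ^+ 2 <= l - v n.
  have := variance_ge0 P (fun w => X n w - Y w).
  rewrite varianceE; last exact: diff_Lfun2.
  have -> : ('E_P[(fun w => X n w - Y w)%R] = - 'E_P[Y])%E.
    have /= := expectationB (Lfun21 (X_Lfun2 n)) Y1.
    by rewrite X_mean0 sub0e.
  have sqrE : ((- m%:E) ^+ 2 = (m ^+ 2)%:E)%E by rewrite /expe/= -EFinM mulrNN.
  rewrite EY sqrE sube_ge0; last by [].
  rewrite -lee_fin => /le_trans; apply.
  by rewrite unlock; exact: sqr_dist_limit.
have : m ^+ 2 <= 0.
  have lv : (l - v n) @[n --> \oo] --> (0 : R).
    by rewrite -(subrr l); apply: cvgB => //; exact: cvg_cst.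
  by apply: (cvgr_to_ge lv); apply: nearW.
rewrite EY => e0; congr EFin; apply/eqP.
by rewrite -sqrf_eq0 eq_le e0 sqr_ge0.
Qed.

(** Fatou gives E Y^2 <= l. Conversely v n = E (Y + (X n - Y))^2 is at most
    (1 + t) E Y^2 + (1 + 1/t) (l - v n) for every t > 0; let n tend to
    infinity, then t to 0. *)
Lemma variance_limit : ('V_P[Y] = l%:E)%E.
Proof.
rewrite varianceE ?limit_Lfun2// expectation_limit expe2 mule0 sube0.
rewrite unlock; change (\int[P]_w (Y w ^+ 2)%:E = l%:E)%E.
have Y2fin : (\int[P]_w (Y w ^+ 2)%:E)%E \is a fin_num.
  rewrite ge0_fin_numE ?(le_lt_trans sqr_limit) ?ltry//.
  by apply: integral_ge0 => w _; rewrite lee_fin sqr_ge0.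
have := sqr_limit; rewrite -(fineK Y2fin).
set a := fine _; rewrite lee_fin => al.
have a0 : 0 <= a.
  by apply: fine_ge0; apply: integral_ge0 => w _; rewrite lee_fin sqr_ge0.
have split_sqr t n : 0 < t -> v n <= (1 + t) * a + (1 + t^-1) * (l - v n).
  move=> t0; have t1 : 0 <= 1 + t by rewrite addr_ge0// ltW.
  have t2 : 0 <= 1 + t^-1 by rewrite addr_ge0// invr_ge0 ltW.
  rewrite -lee_fin -X_sqr EFinD !EFinM.
  apply: (@le_trans _ _ (\int[P]_w ((1 + t)%:E * (Y w ^+ 2)%:E +
     (1 + t^-1)%:E * ((X n w - Y w) ^+ 2)%:E))%E).
    apply: ge0_le_integral => //.
    - by move=> w _; rewrite lee_fin sqr_ge0.
    - by apply/measurable_EFinP; exact: measurable_funX.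
    - by apply: emeasurable_funD; apply: measurable_funeM;
        apply/measurable_EFinP; exact: measurable_funX.
    move=> w _; rewrite -!EFinM -EFinD lee_fin -subr_ge0.
    have -> : (1 + t) * Y w ^+ 2 + (1 + t^-1) * (X n w - Y w) ^+ 2 - X n w ^+ 2 =
       t * (Y w - t^-1 * (X n w - Y w)) ^+ 2.
      by field; rewrite gt_eqF.
    by rewrite mulr_ge0 ?sqr_ge0// ltW.
  rewrite ge0_integralD//; last 4 first.
  - by move=> w _; rewrite mule_ge0// lee_fin// sqr_ge0.
  - by apply: measurable_funeM; apply/measurable_EFinP; exact: measurable_funX.
  - by move=> w _; rewrite mule_ge0// lee_fin// sqr_ge0.
  - by apply: measurable_funeM; apply/measurable_EFinP; exact: measurable_funX.
  rewrite !ge0_integralZl_EFin//; last 4 first.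
  - by move=> w _; rewrite lee_fin sqr_ge0.
  - by apply/measurable_EFinP; exact: measurable_funX.
  - by move=> w _; rewrite lee_fin sqr_ge0.
  - by apply/measurable_EFinP; exact: measurable_funX.
  apply: leeD; first by rewrite /a fineK.
  by rewrite lee_wpmul2l ?lee_fin// sqr_dist_limit.
have la t : 0 < t -> l <= (1 + t) * a.
  move=> t0; apply: (ler_cvg_to vl _ (nearW _ (fun n => split_sqr t n t0))).
  rewrite -[X in _ --> X]addr0 -(mulr0 (1 + t^-1)).
  apply: cvgD; first exact: cvg_cst.
  apply: cvgMr; rewrite -(subrr l); apply: cvgB => //; exact: cvg_cst.
congr EFin; apply/eqP; rewrite eq_le al/=.
apply/ler_addgt0Pr => e e0.
have a1 : 0 < a + 1 by rewrite ltr_wpDl.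
have := la (e / (a + 1)) (divr_gt0 e0 a1).
rewrite mulrDl mul1r => /le_trans; apply; rewrite lerD2l.
by rewrite mulrAC ler_pdivrMr// ler_pM2l// lerDl.
Qed.

End mean_square_limit.

Lemma non_degenerate_variance (R : realType) d (Omega : measurableType d)
    (P : probability Omega R) (Y : {RV P >-> R}) :
  (Y : Omega -> R) \in Lfun P 2%:E -> (0 < 'V_P[Y])%E -> non_degenerate P Y.
Proof.
move=> Y2 + [c Yc]; rewrite varianceE//.
have mY : measurable_fun setT Y by exact: measurable_funPT.
have Ef (f : R -> R) : measurable_fun setT f ->
    (\int[P]_w (f (Y w))%:E = (f c)%:E)%E.
  move=> mf; rewrite (ae_eq_integral (cst (f c)%:E))//.
  - by rewrite integral_cst// [X in (_ * X)%E]probability_setT mule1.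
  - by apply/measurable_EFinP; exact: measurableT_comp.
  - by apply: filterS Yc => w -> _.
rewrite unlock; have -> : (\int[P]_w (Y w)%:E = c%:E)%E by exact: (Ef id).
have -> : (\int[P]_w ((Y ^+ 2) w)%:E = (c ^+ 2)%:E)%E.
  exact: (Ef (fun x => x ^+ 2) (measurable_funX _ _)).
have -> : (c%:E ^+ 2 = (c ^+ 2)%:E)%E by [].
by rewrite subee// ltxx.
Qed.

(** * Functions of the first draws *)

(** The driving sequence coded by a list: the value at time i >= 1 is stored at
    position i.-1, and times beyond the list get the junk value 0. *)
Definition drive (v : seq nat) (i : nat) : nat := nth 0%N v i.-1.

Definition agree (n : nat) (u u' : nat -> nat) : Prop :=
  forall i, (1 <= i <= n)%N -> u i = u' i.

(** Composed with the random draws, these are exactly the functions measurable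
    at time n + 1 of the clock, when n draws have been made. *)
Definition local T (n : nat) (f : (nat -> nat) -> T) : Prop :=
  forall u u', agree n u u' -> f u = f u'.

Lemma agreeW m n u u' : (m <= n)%N -> agree n u u' -> agree m u u'.
Proof. by move=> mn a i /andP[i1 im]; rewrite a// i1 (leq_trans im). Qed.

Lemma localW T m n (f : (nat -> nat) -> T) :
  (m <= n)%N -> local m f -> local n f.
Proof. by move=> mn lf u u' /(agreeW mn)/lf. Qed.

Lemma local_op2 T1 T2 T n (op : T1 -> T2 -> T) f g :
  local n f -> local n g -> local n (fun u => op (f u) (g u)).
Proof. by move=> lf lg u u' a; rewrite (lf _ _ a) (lg _ _ a). Qed.

Lemma local_op1 T1 T n (op : T1 -> T) f :
  local n f -> local n (fun u => op (f u)).
Proof. by move=> lf u u' a; rewrite (lf _ _ a). Qed.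

Lemma drive_rcons_last v j : drive (rcons v j) (size v).+1 = j.
Proof. by rewrite /drive nth_rcons ltnn eqxx. Qed.

Lemma agree_drive_rcons v j : agree (size v) (drive (rcons v j)) (drive v).
Proof.
by move=> i /andP[i1 iv]; rewrite /drive nth_rcons prednK ?iv.
Qed.

Lemma local_rcons T n (f : (nat -> nat) -> T) v j : local n f -> size v = n ->
  f (drive (rcons v j)) = f (drive v).
Proof. by move=> lf sv; apply: lf; rewrite -sv; exact: agree_drive_rcons. Qed.

Lemma agree_drive n u : agree n u (drive [seq u i | i <- iota 1 n]).
Proof.
move=> i /andP[i1 iln]; rewrite /drive (nth_map 0%N) ?size_iota ?prednK//.
by rewrite nth_iota ?prednK// add1n prednK.
Qed.

Lemma agree_drive_inj n v v' : size v = n -> size v' = n ->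
  agree n (drive v) (drive v') -> v = v'.
Proof.
move=> sv sv' a; apply: (@eq_from_nth _ 0%N); first by rewrite sv sv'.
by move=> i iv; apply: (a i.+1); rewrite -sv.
Qed.

Fixpoint draws (n : nat) : seq (seq nat) :=
  if n is m.+1 then [seq rcons v j | v <- draws m, j <- iota 1 n]
  else [:: [::]].

Lemma size_draws n : size (draws n) = n`!.
Proof.
elim: n => // n IHn; rewrite [draws _]/=.
rewrite (size_allpairs (fun v j => rcons v j) (draws n) (iota 1 n.+1)).
by rewrite IHn size_iota factS mulnC.
Qed.

Lemma mem_draws_rcons n v j :
  (rcons v j \in draws n.+1) = (v \in draws n) && (1 <= j <= n.+1)%N.
Proof.
have in_iota i : (i \in 1%N :: iota 2 n) = (1 <= i <= n.+1)%N.
  by rewrite -[_ :: _]/(iota 1 n.+1) mem_iota add1n ltnS.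
apply/allpairsP/andP => [[[v' j'] /= [vin jin /rcons_inj [-> ->]]]|[vin jin]].
  by rewrite vin -in_iota.
by exists (v, j); split=> //=; rewrite in_iota.
Qed.

Lemma draws_size n v : v \in draws n -> size v = n.
Proof.
elim: n v => [v|n IHn v]; first by rewrite inE => /eqP ->.
case/lastP: v => [|v j].
  by move=> /allpairsP[[v j] /= [_ _ /(congr1 size)]]; rewrite size_rcons.
by rewrite mem_draws_rcons size_rcons => /andP[/IHn ->].
Qed.

Lemma draws_uniq n : uniq (draws n).
Proof.
elim: n => // n IHn; apply: (allpairs_uniq (f := fun v j => rcons v j)) => //.
  exact: iota_uniq.
by move=> [v j] [v' j'] _ _ /= /rcons_inj [-> ->].
Qed.

Lemma draws_bound n v i : v \in draws n -> (1 <= i <= n)%N ->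
  (1 <= drive v i <= i)%N.
Proof.
elim: n v => [v|n IHn v vin]; first by case: i.
case/lastP: v vin => [/draws_size//|v j].
rewrite mem_draws_rcons => /andP[vin j1] /andP[i1].
rewrite leq_eqVlt => /predU1P[->|]; last first.
  rewrite ltnS => iln; rewrite (agree_drive_rcons j (i := i)) ?i1 ?(draws_size vin)//.
  by apply: IHn => //; rewrite i1.
by have := drive_rcons_last v j; rewrite (draws_size vin) => ->.
Qed.

Lemma mem_draws n u : (forall i, (1 <= i <= n)%N -> (1 <= u i <= i)%N) ->
  [seq u i | i <- iota 1 n] \in draws n.
Proof.
elim: n => [|n IHn] ub; first by rewrite inE.
rewrite -[X in iota 1 X]addn1 iotaD map_cat cats1 mem_draws_rcons add1n ub ?ltnSn//.
by rewrite IHn// => i /andP[i1 iln]; apply: ub; rewrite i1 ltnW.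
Qed.

(** * Averages over the first draws *)

Section average.
Variable R : realType.
Implicit Types f g h X : (nat -> nat) -> R.

Definition avg n f : R := (n`!)%:R^-1 * \sum_(v <- draws n) f (drive v).

Lemma eq_avg n f g : (forall v, v \in draws n -> f (drive v) = g (drive v)) ->
  avg n f = avg n g.
Proof. by move=> fg; congr (_ * _); apply: eq_big_seq. Qed.

Lemma avgD n f g : avg n (fun u => f u + g u) = avg n f + avg n g.
Proof. by rewrite /avg big_split mulrDr. Qed.

Lemma avgZ n c f : avg n (fun u => c * f u) = c * avg n f.
Proof. by rewrite /avg -mulr_sumr mulrCA. Qed.

Lemma avg_cst n c : avg n (fun=> c) = c.
Proof.
rewrite /avg big_const_seq count_predT size_draws iter_addr_0.
by rewrite -[c *+ _]mulr_natl mulKf// pnatr_eq0 -lt0n fact_gt0.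
Qed.

Lemma avgB n f g : avg n (fun u => f u - g u) = avg n f - avg n g.
Proof.
rewrite -[- avg n g]mulN1r -avgZ -avgD.
by apply: eq_avg => v _; rewrite mulN1r.
Qed.

Lemma le_avg n f g : (forall v, v \in draws n -> f (drive v) <= g (drive v)) ->
  avg n f <= avg n g.
Proof.
move=> fg; rewrite ler_wpM2l ?invr_ge0//.
by rewrite !big_seq; apply: ler_sum => v vin; exact: fg.
Qed.

(** The tower property: averaging over the last draw first. *)
Lemma avg_step n f g :
  (forall v, v \in draws n ->
     \sum_(1 <= j < n.+2) f (drive (rcons v j)) = n.+1%:R * g (drive v)) ->
  avg n.+1 f = avg n g.
Proof.
move=> fg; rewrite /avg big_allpairs_dep/=.
rewrite (eq_big_seq (fun v => n.+1%:R * g (drive v))); last first.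
  by move=> v vin; rewrite -fg// /index_iota subn1.
by rewrite -mulr_sumr factS natrM invfM mulrACA mulVf ?mul1r.
Qed.

Lemma avg_local n f : local n f -> avg n.+1 f = avg n f.
Proof.
move=> lf; apply: avg_step => v /draws_size sv.
under eq_big_nat do rewrite (local_rcons _ lf sv).
by rewrite sumr_const_nat subn1 mulr_natl.
Qed.

(** Both sides are multiplied by the number n.+1 of values of the last draw:
    this is the martingale property, with the conditional expectation written
    as an average. *)
Definition mean_preserving (X : nat -> (nat -> nat) -> R) : Prop :=
  forall n v, v \in draws n ->
    \sum_(1 <= j < n.+2) X n.+1 (drive (rcons v j)) = n.+1%:R * X n (drive v).

Section discrete_martingale.
Variable X : nat -> (nat -> nat) -> R.
Hypothesis X_local : forall n, local n (X n).
Hypothesis X_mean : mean_preserving X.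

Lemma avg_martingale1 n h : local n h ->
  avg n.+1 (fun u => h u * X n.+1 u) = avg n (fun u => h u * X n u).
Proof.
move=> lh; apply: avg_step => v vin.
under eq_big_nat do rewrite (local_rcons _ lh (draws_size vin)).
by rewrite -mulr_sumr X_mean// mulrCA.
Qed.

Lemma avg_martingale m n h : (m <= n)%N -> local m h ->
  avg n (fun u => h u * X n u) = avg m (fun u => h u * X m u).
Proof.
move=> /subnK <- lh; elim: (n - m)%N => // k IHk.
by rewrite addSn avg_martingale1//; apply: localW lh; exact: leq_addl.
Qed.

(** Orthogonality of martingale increments. *)
Lemma avg_sqr_increment m n : (m <= n)%N ->
  avg n (fun u => (X n u - X m u) ^+ 2) =
  avg n (fun u => X n u ^+ 2) - avg m (fun u => X m u ^+ 2).
Proof.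
move=> mn.
have E : avg n (fun u => X m u * X n u) = avg m (fun u => X m u ^+ 2).
  rewrite (avg_martingale mn (@X_local m)).
  by apply: eq_avg => v _; rewrite expr2.
have F : avg n (fun u => X m u ^+ 2) = avg m (fun u => X m u ^+ 2).
  move: mn => /subnK <-; elim: (n - m)%N => // k <-.
  rewrite addSn; apply: avg_local.
  apply: (@local_op1 R R _ (fun x => x ^+ 2) (X m)).
  by apply: localW (@X_local m); exact: leq_addl.
rewrite (eq_avg (g := fun u => X n u ^+ 2 + ((-2) * (X m u * X n u) + X m u ^+ 2))).
  by rewrite avgD avgD avgZ E F; ring.
by move=> v _; ring.
Qed.

(** Expanding the square of (X n.+1 - X n) + (X n - c), the cross term averages
    to zero. Since h and c may depend on the past, this yields the
    submartingale property of squared distances over any past event. *)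
Lemma avg_sqr_submartingale n h c : local n h -> local n c ->
    (forall u, 0 <= h u) ->
  avg n (fun u => h u * (X n u - c u) ^+ 2) <=
  avg n.+1 (fun u => h u * (X n.+1 u - c u) ^+ 2).
Proof.
move=> lh lc h0.
have lX := @X_local n.
rewrite -(avg_local (n := n)); last first.
  apply: local_op2 => //; apply: (@local_op1 R R _ (fun x => x ^+ 2)).
  exact: (local_op2 (fun x y => x - y)).
rewrite -subr_ge0 -avgB.
rewrite (eq_avg (g := fun u => h u * (X n.+1 u - X n u) ^+ 2
    + 2 * ((h u * (X n u - c u)) * X n.+1 u - (h u * (X n u - c u)) * X n u))).
  rewrite avgD avgZ avgB avg_martingale1; last first.
    apply: (local_op2 (fun x y => x * y)) => //.
    exact: (local_op2 (fun x y => x - y)).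
  rewrite [X in _ + 2 * (_ - X)]avg_local; last first.
    apply: (local_op2 (fun x y => x * y)) => //.
    apply: (local_op2 (fun x y => x * y)) => //.
    exact: (local_op2 (fun x y => x - y)).
  rewrite subrr mulr0 addr0 -[leLHS](avg_cst n.+1).
  by apply: le_avg => v _; rewrite mulr_ge0// sqr_ge0.
by move=> v _; ring.
Qed.

End discrete_martingale.
End average.

(** * Moments of the clock *)

Lemma clock_hist_local n : local n (clock_hist^~ n.+1).
Proof.
elim: n => [|n IHn] u u' a; first by [].
rewrite ![clock_hist _ n.+2]/= -![rcons (clock_hist _ n) _]/(clock_hist _ n.+1).
by rewrite (IHn u u' (agreeW (leqnSn n) a)) (a n.+1)//= leqnn.
Qed.

Lemma clock_local n : local n (clock^~ n.+1).
Proof. by move=> u u' /clock_hist_local; rewrite /clock => ->. Qed.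

Lemma clock_localW n k : (k <= n.+1)%N -> local n (clock^~ k).
Proof. by case: k => [//|k]; rewrite ltnS => kn; apply: localW (@clock_local k). Qed.

Lemma clock_drive_rcons n v j : v \in draws n -> (1 <= j <= n.+1)%N ->
  clock (drive (rcons v j)) n.+2 = (1 + clock (drive v) j)%N.
Proof.
move=> vin /andP[j1 jn]; have sv := draws_size vin.
have uj : drive (rcons v j) n.+1 = j by rewrite -sv drive_rcons_last.
rewrite clock_succ// uj ?j1//; congr (1 + _)%N.
exact: (local_rcons j (clock_localW jn) sv).
Qed.

Section moments.
Variable R : realType.

Definition clock_sum n (u : nat -> nat) : R :=
  (\sum_(1 <= k < n.+1) clock u k)%N%:R.

Definition clock_sqsum n (u : nat -> nat) : R :=
  (\sum_(1 <= k < n.+1) clock u k ^ 2)%N%:R.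

Lemma clock_sum_local n : local n (clock_sum n.+1).
Proof.
move=> u u' a; congr (_%:R); apply: eq_big_nat => k /andP[_ kn].
exact: clock_localW a.
Qed.

Lemma clock_sum_drive_rcons n v j : v \in draws n -> (1 <= j <= n.+1)%N ->
  clock_sum n.+2 (drive (rcons v j)) =
  clock_sum n.+1 (drive v) + 1 + (clock (drive v) j)%:R.
Proof.
move=> vin jn; rewrite /clock_sum big_nat_recr//= natrD clock_drive_rcons//.
rewrite natrD addrA; congr (_ + _ + _).
exact: (local_rcons j (@clock_sum_local n) (draws_size vin)).
Qed.

Lemma clock_sqsum_drive_rcons n v j : v \in draws n -> (1 <= j <= n.+1)%N ->
  clock_sqsum n.+2 (drive (rcons v j)) =
  clock_sqsum n.+1 (drive v) + (1 + (clock (drive v) j)%:R) ^+ 2.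
Proof.
move=> vin jn; rewrite /clock_sqsum big_nat_recr//= natrD clock_drive_rcons//.
rewrite natrX natrD; congr (_%:R + _).
apply: eq_big_nat => k /andP[_ kn]; congr (_ ^ 2)%N.
exact: (local_rcons j (clock_localW (kn : (k <= n.+1)%N)) (draws_size vin)).
Qed.

Lemma sum_clock n u :
  \sum_(1 <= j < n.+2) (clock u j)%:R = clock_sum n.+1 u.
Proof. by rewrite /clock_sum natr_sum. Qed.

Lemma sum_clock_sqr n u :
  \sum_(1 <= j < n.+2) (clock u j)%:R ^+ 2 = clock_sqsum n.+1 u.
Proof. by rewrite /clock_sqsum natr_sum; under [RHS]eq_bigr do rewrite natrX. Qed.

Definition harm n : R := \sum_(0 <= k < n) k.+1%:R^-1.

Lemma harm1 : harm 1 = 1.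
Proof. by rewrite /harm big_nat1 invr1. Qed.

Lemma harmS n : harm n.+1 = harm n + n.+1%:R^-1.
Proof. by rewrite /harm big_nat_recr. Qed.

Lemma harm2_1 : harm2 R 1 = 1.
Proof. by rewrite /harm2 big_nat1 expr1n invr1. Qed.

Lemma harm2S n : harm2 R n.+1 = harm2 R n + n.+1%:R ^- 2.
Proof. by rewrite /harm2 big_nat_recr. Qed.

(** Conditionally on the past, T_(n+2) is on average 1 + S_(n+1) / (n+1); hence
    E S_n / n increases by 1 / (n+1) at each step. *)
Lemma avg_clock_sum n : avg n (clock_sum n.+1) = n.+1%:R * (harm n.+1 - 1).
Proof.
elim: n => [|n IHn].
  rewrite harm1 subrr mulr0 /avg big_seq1 /clock_sum big_nat1 clock_one.
  by rewrite mulr0.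
rewrite (avg_step (g := fun u => clock_sum n.+1 u + (1 + n.+1%:R^-1 * clock_sum n.+1 u))).
  rewrite avgD avgD avg_cst avgZ IHn [harm n.+2]harmS; field.
  by rewrite -!natrD nat1r !pnatr_eq0.
move=> v vin; under eq_big_nat => j jn do rewrite clock_sum_drive_rcons//.
rewrite big_split/= sum_clock sumr_const_nat subn1/= -[_ *+ _]mulr_natl.
by field; rewrite nat1r pnatr_eq0.
Qed.

(** The same recursion for (1 + T)^2 = 1 + 2 T + T^2. *)
Lemma avg_clock_sqsum n : avg n (clock_sqsum n.+1) =
  n.+1%:R * (harm n.+1 ^+ 2 - harm2 R n.+1 - harm n.+1 + 1).
Proof.
elim: n => [|n IHn].
  rewrite harm1 harm2_1 /avg big_seq1 /clock_sqsum big_nat1 clock_one.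
  by ring.
rewrite (avg_step (g := fun u => (1 + n.+1%:R^-1) * clock_sqsum n.+1 u +
    (1 + 2 * n.+1%:R^-1 * clock_sum n.+1 u))).
  rewrite avgD avgZ avgD avg_cst avgZ IHn avg_clock_sum.
  rewrite [harm n.+2]harmS [harm2 R n.+2]harm2S; field.
  by rewrite -!natrD nat1r !pnatr_eq0.
move=> v vin; under eq_big_nat => j jn.
  rewrite clock_sqsum_drive_rcons// sqrrD expr1n mul1r addrA -mulr_natl.
  over.
rewrite !big_split/= sum_clock_sqr -mulr_sumr sum_clock !sumr_const_nat subn1/=.
rewrite -[clock_sqsum _ _ *+ _]mulr_natl.
by field; rewrite nat1r pnatr_eq0.
Qed.

(** The martingale of the theorem at time n + 1, the time at which n draws have
    been used. *)
Definition clock_mart n (u : nat -> nat) : R :=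
  n.+1%:R^-1 * (clock_sum n.+1 u - n.+1%:R * (harm n.+1 - 1)).

Lemma clock_mart_local n : local n (clock_mart n).
Proof. by move=> u u' a; rewrite /clock_mart (clock_sum_local a). Qed.

Lemma clock_martS n v j : v \in draws n -> (1 <= j <= n.+1)%N ->
  clock_mart n.+1 (drive (rcons v j)) = clock_mart n (drive v) +
   n.+2%:R^-1 * ((clock (drive v) j)%:R - n.+1%:R^-1 * clock_sum n.+1 (drive v)).
Proof.
move=> vin jn; rewrite /clock_mart clock_sum_drive_rcons// [harm n.+2]harmS.
by field; rewrite -!natrD nat1r !pnatr_eq0.
Qed.

Lemma clock_mart_mean : mean_preserving clock_mart.
Proof.
move=> n v vin; under eq_big_nat => j jn do rewrite clock_martS//.
rewrite big_split/= -[X in _ + X]mulr_sumr sumrB sum_clock !sumr_const_nat subn1/=.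
rewrite -[_ * clock_sum _ _ *+ _]mulr_natl -[clock_mart _ _ *+ _]mulr_natl.
by field; rewrite -!natrD nat1r !pnatr_eq0.
Qed.

Lemma avg_clock_mart n : avg n (clock_mart n) = 0.
Proof.
by rewrite avgZ avgB avg_cst avg_clock_sum subrr mulr0.
Qed.

(** The conditional second moment of the increment is (n+2)^-2 times the
    empirical variance of T_1, ..., T_(n+1), whose mean follows from the two
    previous averages. This gives the linear recursion
    v' = v + (H - H2 - v) / (n+2)^2, solved by the right-hand side. *)
Lemma avg_clock_mart_sqr n : avg n (fun u => clock_mart n u ^+ 2) =
  2 - harm2 R n.+1 - harm n.+1 / n.+1%:R.
Proof.
elim: n => [|n IHn].
  rewrite harm2_1 harm1 /avg big_seq1 /clock_mart /clock_sum big_nat1 clock_one.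
  by rewrite harm1; field.
rewrite (avg_step (g := fun u => clock_mart n u ^+ 2 + n.+2%:R ^- 2 *
   (n.+1%:R^-1 * clock_sqsum n.+1 u -
    (clock_mart n u ^+ 2 +
      (2 * (harm n.+1 - 1) * clock_mart n u + (harm n.+1 - 1) ^+ 2))))).
  rewrite avgD avgZ avgB avgZ avg_clock_sqsum !avgD avgZ avg_cst avg_clock_mart IHn.
  rewrite [harm n.+2]harmS [harm2 R n.+2]harm2S; field.
  by rewrite -!natrD nat1r !pnatr_eq0.
move=> v vin; set u := drive v; set s := clock_sum n.+1 u.
have MS : clock_mart n u = n.+1%:R^-1 * s - (harm n.+1 - 1).
  by rewrite /clock_mart -/s; field; rewrite nat1r pnatr_eq0.
(* b is the part of the next value that does not depend on the draw j *)
pose b := clock_mart n u - n.+2%:R^-1 * (n.+1%:R^-1 * s).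
have jumpE j : (1 <= j < n.+2)%N -> clock_mart n.+1 (drive (rcons v j)) ^+ 2 =
    b ^+ 2 + (2 * b * n.+2%:R^-1 * (clock u j)%:R +
      n.+2%:R ^- 2 * (clock u j)%:R ^+ 2).
  move=> jn; rewrite clock_martS// -/u -/s /b.
  by field; rewrite -!natrD nat1r !pnatr_eq0.
rewrite (eq_big_nat _ _ jumpE) !big_split/= -!mulr_sumr sum_clock sum_clock_sqr -/s.
rewrite sumr_const_nat subn1/= -[_ *+ n.+1]mulr_natl /b MS.
by field; rewrite -!natrD nat1r !pnatr_eq0.
Qed.

End moments.

(** * The law of the first draws *)

Section uniform_draws.
Context (R : realType) d (Omega : measurableType d) (P : probability Omega R).
Variable U : nat -> {RV P >-> nat}.

Definition traj (w : Omega) : nat -> nat := fun n => U n w.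

Lemma local_event_bigcup n (C : (nat -> nat) -> Prop) : local n C ->
  [set w | C (traj w)] =
  \bigcup_(v in [set v | C (drive v)]) [set w | agree n (traj w) (drive v)].
Proof.
move=> lC; apply/seteqP; split => [w Cw|w [v /= Cv /lC ->//]].
exists [seq traj w i | i <- iota 1 n] => /=; last exact: agree_drive.
by rewrite -(lC _ _ (@agree_drive n (traj w))).
Qed.

(** An event about the first n draws is a countable union, over the possible
    lists of values, of finite intersections of events about single draws. *)
Lemma local_event_sigma (G : set (set Omega)) n (C : (nat -> nat) -> Prop) :
  sigma_algebra setT G ->
  (forall i k, (1 <= i <= n)%N -> G (U i @^-1` [set k])) ->
  local n C -> G [set w | C (traj w)].
Proof.
move=> sG GU lC.
have E : @measurable _ (g_sigma_algebraType G) = G by exact: sigma_algebra_id.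
rewrite (local_event_bigcup lC) -E bigcup_mkcond.
apply: (@countable_bigcupT_measurable _ (g_sigma_algebraType G)) => // v.
case: ifP => // _.
have -> : [set w | agree n (traj w) (drive v)] =
    \bigcap_(i in [set i | (1 <= i <= n)%N]) (U i @^-1` [set drive v i]) by [].
apply: (@bigcap_measurableType _ (g_sigma_algebraType G)) => i /= i1n.
by rewrite E; exact: GU.
Qed.

Lemma measurable_local_event n (C : (nat -> nat) -> Prop) : local n C ->
  measurable [set w | C (traj w)].
Proof.
apply: local_event_sigma; first exact: sigma_algebra_measurable.
by move=> i k _; rewrite -[X in measurable X]setTI; exact: measurable_funPT.
Qed.

Lemma measurable_local n (f : (nat -> nat) -> R) : local n f ->
  measurable_fun setT (f \o traj).
Proof.
move=> lf _ B mB; rewrite setTI.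
apply: (@measurable_local_event n (fun u => B (f u))) => u u' a.
by rewrite (lf _ _ a).
Qed.

Hypothesis U_indep :
  mutually_independent P [set n | (1 <= n)%N] (fun n w => U n w).
Hypothesis U_unif : forall n, (1 <= n)%N -> uniform_on_1_to P n (U n).

(** By independence, the product of the probabilities 1/i for i = 1, ..., n. *)
Lemma prob_draw n v : v \in draws n ->
  P [set w | agree n (traj w) (drive v)] = ((n`!)%:R^-1)%:E.
Proof.
move=> vin.
have := @U_indep [fset i | i in iota 1 n]%fset (fun i => [set drive v i]).
have mem_J i : i \in [fset i | i in iota 1 n]%fset = (1 <= i <= n)%N.
  by rewrite in_fset/= mem_iota add1n ltnS.
move=> /(_ _ (fun i => I)).
have -> : \bigcap_(i in [set` [fset i | i in iota 1 n]%fset])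
    (U i @^-1` [set drive v i]) = [set w | agree n (traj w) (drive v)].
  apply/seteqP; split => w Hw i /= Hi; apply: Hw => /=; first by rewrite mem_J.
  by rewrite mem_J in Hi.
move=> ->; last by move=> i /=; rewrite mem_J => /andP[].
rewrite (perm_big (iota 1 n)); last first.
  apply: uniq_perm; [exact: fset_uniq|exact: iota_uniq|move=> i].
  by rewrite mem_J mem_iota add1n ltnS.
transitivity (\prod_(i <- iota 1 n) (i%:R^-1 : R)%:E)%E.
  apply: eq_big_seq => i; rewrite mem_iota add1n ltnS => i1n.
  have /andP[i1 iln] := i1n.
  by have := U_unif i1 (drive v i); rewrite (draws_bound vin i1n).
rewrite prodEFin; congr (_%:E).
by rewrite prodfV fact_prod natr_prod /index_iota subn1.
Qed.

Lemma traj_bound_ae : {ae P, forall w i, (1 <= i)%N -> (1 <= traj w i <= i)%N}.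
Proof.
apply/ae_foralln => i.
have : P.-negligible (\bigcup_k
   (if (1 <= i)%N && ~~ (1 <= k <= i)%N then U i @^-1` [set k] else set0)).
  apply: negligible_bigcup => k; case: ifPn => [/andP[i1 ki]|_]; last exact: negligible_set0.
  have Pk : P (U i @^-1` [set k]) = 0%E.
    by have := U_unif i1 k; rewrite (negbTE ki).
  apply/negligibleP => //.
  by rewrite -[X in measurable X]setTI; exact: measurable_funPT.
apply: negligibleS => w /= /not_implyP[i1 /negP Nb].
by exists (traj w i) => //; rewrite i1 Nb.
Qed.

(** Almost surely the first n draws form exactly one of the lists in
    [draws n]. *)
Lemma local_decomposition n (f : (nat -> nat) -> R) : local n f ->
  ae_eq P setT (EFin \o f \o traj)
   (fun w => \sum_(v <- draws n)
      (f (drive v))%:E * (\1_[set w | agree n (traj w) (drive v)] w)%:E)%E.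
Proof.
move=> lf; apply: filterS traj_bound_ae => w bw _.
set v := [seq traj w i | i <- iota 1 n].
have vin : v \in draws n by apply: mem_draws => i /andP[i1 _]; exact: bw.
rewrite (bigD1_seq v) ?draws_uniq//= big_seq_cond big1 => [|v' /andP[vin' vv']].
  rewrite adde0 indicE mem_set ?mule1/=; last exact: agree_drive.
  by rewrite (lf _ _ (@agree_drive n (traj w))).
rewrite indicE memNset ?mule0//= => a.
move/negP: vv'; apply; apply/eqP.
apply: (agree_drive_inj (draws_size vin') (draws_size vin)).
by move=> i i1n; rewrite -a// (@agree_drive n (traj w) i i1n).
Qed.

(** The bridge between the probability space and the finite averages: almost
    surely f takes one of n! values, indexed by equally likely lists. *)
Lemma integral_local n (f : (nat -> nat) -> R) : local n f ->
  (\int[P]_w (f (traj w))%:E = (avg n f)%:E)%E.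
Proof.
move=> lf.
have mD v : measurable [set w | agree n (traj w) (drive v)].
  apply: (@measurable_local_event n (fun u => agree n u (drive v))) => u u' a.
  by apply/propext; split => b i i1n; rewrite -b// a.
have iD v : P.-integrable setT (fun w =>
   ((f (drive v))%:E * (\1_[set w | agree n (traj w) (drive v)] w)%:E)%E).
  apply: integrableZl => //; exact: integrable_indic.
transitivity (\int[P]_w \sum_(v <- draws n)
    ((f (drive v))%:E * (\1_[set w | agree n (traj w) (drive v)] w)%:E))%E.
  apply: ae_eq_integral => //.
  - by apply/measurable_EFinP; exact: measurable_local lf.
  - by apply: emeasurable_sum => v; have /integrableP[] := iD v.
  - exact: local_decomposition.
rewrite integral_sum// /avg mulr_sumr -sumEFin.
apply: eq_big_seq => v vin.
rewrite integralZl//; last exact: integrable_indic.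
rewrite integral_indic// setIT EFinM muleC; congr (_ * _)%E.
exact: prob_draw.
Qed.

Lemma expectation_local n (f : (nat -> nat) -> R) : local n f ->
  ('E_P[fun w => f (traj w)] = (avg n f)%:E)%E.
Proof. by move=> lf; rewrite unlock; exact: integral_local. Qed.

Lemma integrable_local n (f : (nat -> nat) -> R) : local n f ->
  P.-integrable setT (EFin \o f \o traj).
Proof.
move=> lf; apply/integrableP; split.
  by apply/measurable_EFinP; exact: measurable_local lf.
have := @integral_local n (fun u => `|f u|) (@local_op1 R R n (fun x => `|x|) f lf).
by rewrite /= => ->; rewrite ltry.
Qed.

Lemma integral_local_event n (C : (nat -> nat) -> Prop)
    (f : (nat -> nat) -> R) :
  local n C -> local n f ->
  (\int[P]_(w in [set w | C (traj w)]) (f (traj w))%:E =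
   (avg n (fun u => (`[< C u >])%:R * f u))%:E)%E.
Proof.
move=> lC lf; rewrite -integral_local; last first.
  apply: (local_op2 (fun x y => x * y)) => // u u' a; by rewrite (lC _ _ a).
rewrite integral_mkcond; apply: eq_integral => w _.
rewrite patchE; case: ifPn => [|] /=.
  by rewrite inE/= => Cw; rewrite asboolT// mul1r.
by rewrite notin_setE/= => Cw; rewrite asboolF// mul0r.
Qed.

(** The events that do not separate two outcomes with the same first n draws
    form a sigma-algebra containing the generators. *)
Lemma clockF_determined n A : clockF (fun n w => U n w) n.+1 A ->
  forall w w', agree n (traj w) (traj w') -> A w -> A w'.
Proof.
set D := [set A : set Omega |
  forall w w', agree n (traj w) (traj w') -> A w -> A w'].
suff : clockF (fun n w => U n w) n.+1 `<=` D by exact.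
apply: smallest_sub.
  split.
  - by move=> w w' _ [].
  - move=> B DB w w' a [_ NB]; split => // Bw'; apply: NB.
    by apply: DB Bw' => i i1n; rewrite a.
  - by move=> F DF w w' a [k _ Fw]; exists k => //; exact: DF a Fw.
move=> B [|] [k /=] kn [S _ <-] w w' a; rewrite !setTI /=.
  rewrite /clockT; case/andP: kn => _ kn.
  by rewrite (clock_localW kn a).
by rewrite -/(traj w k) -/(traj w' k) (a k kn).
Qed.

(** Reduces every statement about the filtration to finite averages; T_1, ...,
    T_(n+1) bring nothing beyond the first n draws. *)
Lemma clockFP n A : clockF (fun n w => U n w) n.+1 A <->
  exists2 C, local n C & A = [set w | C (traj w)].
Proof.
split=> [FA|[C lC ->]].
  exists (fun u => exists2 w, A w & agree n (traj w) u).
    move=> u u' a; apply/propext; split => -[w Aw b]; exists w => // i i1n.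
      by rewrite b// a.
    by rewrite b// a.
  apply/seteqP; split => [w Aw|w /= [w' Aw' a]]; first by exists w.
  exact: clockF_determined a Aw'.
apply: local_event_sigma lC; first exact: smallest_sigma_algebra.
move=> i k i1n; apply: sub_sigma_algebra; right; exists i => //=.
by exists [set k] => //; rewrite setTI.
Qed.

End uniform_draws.

(** * The martingale of the reverting clock *)

Section clock_variance.
Variable R : realType.

(** The variance of the martingale at time n + 1. *)
Definition clock_var n : R := 2 - harm2 R n.+1 - harm R n.+1 / n.+1%:R.

(** H_n / n tends to 0, being the Cesaro mean of the 1/k. *)
Lemma cvg_clock_var : clock_var @ \oo --> 2 - pi ^+ 2 / 6.
Proof.
rewrite -[X in _ --> X]subr0; apply: cvgB.
  apply: cvgB; first exact: cvg_cst.
  by rewrite (cvg_shiftS (harm2 R)); exact: basel.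
have := cesaro (@cvg_harmonic R).
by apply: cvg_trans; apply: near_eq_cvg; apply: nearW => n; rewrite /= mulrC.
Qed.

Lemma clock_var_le2 n : clock_var n <= 2.
Proof.
have h2 : 0 <= harm2 R n.+1.
  by apply: sumr_ge0 => k _; rewrite invr_ge0 exprn_ge0.
have h1 : 0 <= harm R n.+1 / n.+1%:R.
  by rewrite divr_ge0//; apply: sumr_ge0 => k _; rewrite invr_ge0.
by rewrite /clock_var -addrA -opprD gerDl oppr_le0 addr_ge0.
Qed.

(** The first nonzero variance, 1/36. The variances increase, so that this
    bounds the limit from below without any numerical estimate of pi. *)
Lemma clock_var2_gt0 : 0 < clock_var 2.
Proof.
by rewrite /clock_var 2!harm2S 2!harmS harm2_1 harm1; lra.
Qed.

End clock_variance.

Section reverting_clock_martingale.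
Context (R : realType) d (Omega : measurableType d) (P : probability Omega R).
Variable U : nat -> {RV P >-> nat}.
Hypothesis U_indep :
  mutually_independent P [set n | (1 <= n)%N] (fun n w => U n w).
Hypothesis U_unif : forall n, (1 <= n)%N -> uniform_on_1_to P n (U n).

Let M n := clockM P (fun n w => U n w) n.+1.
Let F n := clockF (fun n w => U n w) n.+1.

Lemma clockM_clock_mart n w : M n w = clock_mart R n (traj U w).
Proof.
rewrite /M /clockM /clock_mart; congr (_ * (_ - _)).
have -> : clockS R (fun n w => U n w) n.+1 = (fun w => clock_sum R n.+1 (traj U w)) by [].
by rewrite (expectation_local U_indep U_unif (@clock_sum_local R n)) avg_clock_sum.
Qed.

Let ME n : M n = clock_mart R n \o traj U.
Proof. by apply/funext => w; exact: clockM_clock_mart. Qed.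

Lemma clockF_filtration : filtration (clockF (fun n w => U n w)).
Proof.
split=> [n _|[//|n] _ A /clockFP[C lC ->]|[//|m] [//|n] _ mn A /clockFP[C lC ->]].
- exact: smallest_sigma_algebra.
- exact: measurable_local_event lC.
- by apply/clockFP; exists C => //; exact: localW lC.
Qed.

Lemma clockM_adapted n : measurable_wrt (F n) (M n).
Proof.
move=> _ [B _ <-]; rewrite setTI; apply/clockFP.
exists (fun u => B (clock_mart R n u)); last by rewrite ME.
by move=> u u' /(@clock_mart_local R n) ->.
Qed.

Lemma clockM_integrable n : P.-integrable setT (EFin \o M n).
Proof. rewrite ME; exact: integrable_local (@clock_mart_local R n). Qed.

Let local_indic n (C : (nat -> nat) -> Prop) : local n C ->
  local n (fun u => (`[< C u >])%:R : R).
Proof. by move=> lC u u' a; rewrite (lC _ _ a). Qed.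

Lemma clockM_cond_exp n : is_cond_exp P (F n) (M n.+1) (M n).
Proof.
split; [exact: clockM_adapted|exact: clockM_integrable|].
move=> _ /clockFP[C lC ->].
under eq_integral do rewrite clockM_clock_mart.
under [RHS]eq_integral do rewrite clockM_clock_mart.
rewrite (integral_local_event U_indep U_unif lC (@clock_mart_local R n)).
rewrite (integral_local_event U_indep U_unif (localW (leqnSn n) lC)
  (@clock_mart_local R n.+1)).
by rewrite (avg_martingale1 (@clock_mart_mean R) (local_indic lC)).
Qed.

Let sqr_local m n : (m <= n)%N ->
  local n (fun u => (clock_mart R n u - clock_mart R m u) ^+ 2).
Proof.
move=> mn u u' a.
by rewrite (clock_mart_local R a) (clock_mart_local R (agreeW mn a)).
Qed.

Lemma clockM_sqr_dist m n : (m <= n)%N ->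
  (\int[P]_w ((M n w - M m w) ^+ 2)%:E = (clock_var R n - clock_var R m)%:E)%E.
Proof.
move=> mn; under eq_integral do rewrite !clockM_clock_mart.
rewrite (integral_local U_indep U_unif (sqr_local mn)).
rewrite (avg_sqr_increment (@clock_mart_local R) (@clock_mart_mean R) mn).
by rewrite !avg_clock_mart_sqr.
Qed.

Lemma clockM_sqr n : (\int[P]_w (M n w ^+ 2)%:E = (clock_var R n)%:E)%E.
Proof.
under eq_integral do rewrite clockM_clock_mart.
rewrite (@integral_local _ _ _ _ _ U_indep U_unif n (fun u => clock_mart R n u ^+ 2)).
  by rewrite avg_clock_mart_sqr.
by move=> u u' /(@clock_mart_local R n) ->.
Qed.

Lemma clockM_mean n : ('E_P[M n] = 0)%E.
Proof.
by rewrite ME (expectation_local U_indep U_unif (@clock_mart_local R n)) avg_clock_mart.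
Qed.

Lemma clockM_measurable n : measurable_fun setT (M n).
Proof. by rewrite ME; exact: measurable_local (@clock_mart_local R n). Qed.

Lemma clockM_sqr_submartingale m k A : (m <= k)%N -> F k A ->
  (\int[P]_(w in A) ((M k w - M m w) ^+ 2)%:E <=
   \int[P]_(w in A) ((M k.+1 w - M m w) ^+ 2)%:E)%E.
Proof.
move=> mk /clockFP[C lC ->].
under eq_integral do rewrite !clockM_clock_mart.
under [leRHS]eq_integral do rewrite !clockM_clock_mart.
rewrite (integral_local_event U_indep U_unif lC (sqr_local mk)).
rewrite (integral_local_event U_indep U_unif (localW (leqnSn k) lC)
  (sqr_local (leqW mk))).
rewrite lee_fin.
apply: (avg_sqr_submartingale (@clock_mart_local R) (@clock_mart_mean R)).
- exact: local_indic.
- exact: localW (@clock_mart_local R m).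
- by [].
Qed.

Lemma clockM_ae_cvg : {ae P, forall w, cvgn (M ^~ w)}.
Proof.
have [sF mF ndF] := clockF_filtration.
apply: (@ae_cvg_L2_martingale _ _ _ P F M).
- by move=> k; exact: sF.
- by move=> k; exact: mF.
- by move=> k; exact: ndF.
- exact: clockM_adapted.
- exact: clockM_sqr_submartingale.
move=> e e0; have e2 : 0 < e / 2 by rewrite divr_gt0.
have /cvgrPdist_le/(_ _ e2)[m _ vm] := @cvg_clock_var R.
exists m => n mn; rewrite clockM_sqr_dist// lee_fin.
have := vm n mn; have := vm m (leqnn m); rewrite !ler_norml => /andP[_ +] /andP[+ _].
lra.
Qed.

End reverting_clock_martingale.

Theorem theorem2 (R : realType) (d : measure_display) (Omega : measurableType d)
    (P : probability Omega R) (U : nat -> {RV P >-> nat})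
    (U_indep : mutually_independent P [set n | (1 <= n)%N] (fun n w => U n w))
    (U_unif : forall n : nat, (1 <= n)%N -> uniform_on_1_to P n (U n)) :
  martingale P (clockF (fun n w => U n w)) (clockM P (fun n w => U n w)) /\
  L2_bounded P (clockM P (fun n w => U n w)) /\
  exists Mlim : {RV P >-> R},
    [/\ cvg_almost_surely P (clockM P (fun n w => U n w)) Mlim,
        cvg_mean_square P (clockM P (fun n w => U n w)) Mlim,
        non_degenerate P Mlim,
        ('E_P[Mlim] = 0)%E
      & ('V_P[Mlim] = (2 - pi ^+ 2 / 6)%R%:E)%E].
Proof.
split; last split.
- split; first exact: clockF_filtration.
  + by move=> [//|n] _; exact: clockM_adapted.
  + by move=> [//|n] _; exact: clockM_integrable.
  + by move=> [//|n] _; exact: clockM_cond_exp.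
- apply: (@le_lt_trans _ _ 2%:E); last exact: ltry.
  apply: ge_ereal_sup => _ [[//|n] _ <-].
  by rewrite unlock clockM_sqr// lee_fin clock_var_le2.
have mM := clockM_measurable U_indep U_unif.
have [Y MY] := ae_limit_RV mM (clockM_ae_cvg U_indep U_unif).
have M0 := clockM_mean U_indep U_unif.
have M2 := clockM_sqr U_indep U_unif.
have MD := clockM_sqr_dist U_indep U_unif.
have vl := @cvg_clock_var R.
have VY := variance_limit mM MY M0 M2 MD vl.
have Y2 := limit_Lfun2 mM MY M2 vl.
have EY := expectation_limit mM MY M0 M2 MD vl.
exists Y; split => //.
- by apply: filterS MY => w MYw; rewrite -cvg_shiftS.
- have [_ MY2] := mean_square_limit mM MY M2 MD vl.
  by split=> //; rewrite -cvg_shiftS.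
- apply: non_degenerate_variance => //; rewrite VY lte_fin.
  apply: (lt_le_trans (clock_var2_gt0 R)).
  (* the squared distance of the third term to the limit is nonnegative *)
  rewrite -subr_ge0 -lee_fin; apply: le_trans (sqr_dist_limit mM MY MD vl 2).
  by apply: integral_ge0 => w _; rewrite lee_fin sqr_ge0.
Qed.
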